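(* For $0<x<1$, as $n\to\infty$, $${}_n\beta_0(x,0)\to-\ln(1-x).$$
   Context: For each $n\geq 2$, let $U_1,\dots,U_{n-1}$ be an independent sample from the uniform distribution on $[0,1]$ with order statistic $0<U_{n:1}<\dots<U_{n:n-1}<1$, and put $U_{n:0}=0$, $U_{n:n}=1$. The spacings are $S_k=U_{n:k}-U_{n:k-1}$, $1\le k\le n$, and $0<S_{n:1}<\dots<S_{n:n}<1$ denotes the order statistic of the spacings. One has $E S_{n:i}=\frac1n\sum_{j=1}^i\frac{1}{n+1-j}$ for $1\le i\le n$. The expected Betti--0 function of $n$ uniform points on the circle (of total length one) is defined by ${}_n\beta_0(x,0)=c_n\,E S_{n:\lceil(n-1)x\rceil}$, where the normalizing constant $c_n=\frac{n-1}{1-ES_{n:n}}$ is chosen so that $\int_0^1{}_n\beta_0(x,0)\,dx=1$. Explicitly, $${}_n\beta_0(x,0)=\frac{c_n}{n}\sum_{j=1}^{\lceil(n-1)x\rceil}\frac{1}{n+1-j}.$$ *)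

(* Defs.v *)
From HB Require Import structures.
From mathcomp Require Import all_boot all_order all_algebra.
From mathcomp Require Import all_classical all_reals all_analysis.

Set Implicit Arguments.
Unset Strict Implicit.
Unset Printing Implicit Defensive.

Import Order.TTheory GRing.Theory Num.Theory.
Import numFieldNormedType.Exports.

Local Open Scope classical_set_scope.
Local Open Scope ring_scope.

Definition mutually_independent (R : realType) (d : measure_display)
    (T : measurableType d) (P : probability T R) (I : finType)
    (X : I -> {RV P >-> R}) : Prop :=
  forall (J : {set I}) (A : I -> set R), (forall i, measurable (A i)) ->
    P (\bigcap_(i in [set` J]) (X i @^-1` A i)) =
    (\prod_(i in J) P (X i @^-1` A i))%E.

Definition uniform01_sample (R : realType) (d : measure_display)
    (T : measurableType d) (P : probability T R) (I : finType)
    (X : I -> {RV P >-> R}) : Prop :=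
  mutually_independent X /\
  forall i (A : set R), measurable A ->
    distribution P (X i) A = uniform_prob (@ltr01 R) A.

(* The index [k] is 1-based; the value is junk unless 1 <= k <= size s. *)
Definition order_statistic (R : realType) (s : seq R) (k : nat) : R :=
  nth 0 (sort <=%R s) k.-1.

(* The points U_{n:0} = 0, U_{n:1}, ..., U_{n:n-1}, U_{n:n} = 1 in this order,
   where [u] lists the n - 1 unordered sample values. *)
Definition endpoints (R : realType) (u : seq R) : seq R :=
  0 :: rcons (sort <=%R u) 1.

(* S_1, ..., S_n, where n - 1 = size u. *)
Definition spacings (R : realType) (u : seq R) : seq R :=
  [seq nth 0 (endpoints u) k - nth 0 (endpoints u) k.-1
     | k <- iota 1 (size u).+1].

Section Betti0.
Context {R : realType} {d : measure_display} {T : measurableType d}.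
Context {P : probability T R}.
Variables (n : nat) (U : 'I_n.-1 -> {RV P >-> R}).

(* S_{n:k} as a function on the sample space. *)
Definition ordered_spacing (k : nat) : T -> R :=
  fun t => order_statistic (spacings [seq U i t | i <- enum 'I_n.-1]) k.

(* E S_{n:k}; spacings of points in [0, 1] lie in [0, 1], so that for a uniform
   sample the expectation is finite and [fine] only changes its type. *)
Definition mean_ordered_spacing (k : nat) : R :=
  fine ('E_P[ordered_spacing k])%E.

Definition betti0_const : R := n.-1%:R / (1 - mean_ordered_spacing n).

(* For 0 < x the ceiling is nonnegative, so that [absz] only changes its
   type. *)
Definition expected_betti0 (x : R) : R :=
  betti0_const * mean_ordered_spacing (absz (Num.ceil (n.-1%:R * x))).
End Betti0.

(* Main.v *)
Require Import Defs.
From HB Require Import structures.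
From mathcomp Require Import all_boot all_order all_algebra.
From mathcomp Require Import all_classical all_reals all_analysis.
From mathcomp Require Import measurable_realfun.
From mathcomp Require Import zify ring lra.

Set Implicit Arguments.
Unset Strict Implicit.
Unset Printing Implicit Defensive.

Import Order.TTheory GRing.Theory Num.Theory.
Import numFieldNormedType.Exports.

Local Open Scope classical_set_scope.
Local Open Scope ring_scope.

(** Write m = n - 1 for the number of points and k for the ceiling of m x. The
    value of the expected Betti-0 function is m E S_{n:k} / (1 - E S_{n:n}), so it
    suffices that m E S_{n:k} tends to - ln (1 - x) and that E S_{n:n} tends to 0.

    The first limit is a law of large numbers. The spacing S_{n:k} exceeds s / m
    exactly when at least n - k + 1 spacings do ([order_statistic_gt]), and n - k
    is m (1 - x) up to a unit ([rank_bounds]). Up to the first spacing, the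
    spacings longer than a = s / m are counted by the points followed by a gap
    longer than a; for a sample with ties the count lies between that of the
    untied points with this property and that of all points, ties being
    disregarded ([le_count_spacings], [count_spacings_le]). A given point is
    followed by such a gap with probability (1 - a) ^ m, and two given points
    both are with probability (1 - 2 a) ^ m; as m grows these tend to exp (- s)
    and exp (- 2 s), so that by Chebyshev's inequality the proportion of points
    followed by a gap longer than s / m tends to exp (- s) in probability
    ([gaps_concentrate]). Comparing exp (- s) with 1 - x shows that m S_{n:k}
    tends to - ln (1 - x) in probability. The means converge too, because the
    spacings of rank at least k have sum at most 1, which bounds m S_{n:k} by
    1 / (1 - x) ([mean_spacing_upper], [mean_spacing_lower]).

    The exact gap probabilities are replaced by one-sided bounds obtained by
    cutting [0, 1[ into M = m ^ 2 cells and fixing the cells of the points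
    considered: the events then become products of intervals, and independence
    applies directly, without integrating over the positions of these points
    ([prob_closed_gap_ge], [prob_open_gap_pair]).

    For the second limit, a spacing longer than 2 / K leaves one of K equal cells
    empty, which has probability at most K (1 - 1 / K) ^ m
    ([cvg_mean_largest_spacing]). *)

(** * Order statistics and spacings of a finite sequence *)

Lemma sub_in_count (T : eqType) (p q : pred T) (s : seq T) :
  {in s, forall x, p x -> q x} -> (count p s <= count q s)%N.
Proof.
move=> pq; rewrite (eq_in_count (a2 := predI p q)); last first.
  by move=> x xs /=; case: (boolP (p x)) => //= px; rewrite (pq x).
by apply: sub_count => x /andP[].
Qed.

Section OrderStatistics.
Context {R : realType}.
Implicit Types (s : seq R) (k : nat) (a : R).

Lemma nth_sort_le s i j : (i <= j < size s)%N ->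
  nth 0 (sort <=%R s) i <= nth 0 (sort <=%R s) j.
Proof.
move=> /andP[ij js]; apply: sorted_leq_nth => //.
- exact: le_trans.
- exact: sort_le_sorted.
- by rewrite inE size_sort; exact: leq_ltn_trans js.
- by rewrite inE size_sort.
Qed.

Lemma count_sort (p : pred R) s : count p (sort <=%R s) = count p s.
Proof. by apply/permP; rewrite perm_sort. Qed.

(** The k-th smallest term exceeds a exactly when fewer than k terms do not. *)
Lemma order_statistic_gt s k a : (0 < k <= size s)%N ->
  (a < order_statistic s k) = (size s < k + count (> a) s)%N.
Proof.
case: k => // k /= ks; rewrite /order_statistic /=.
rewrite -count_sort; have := @nth_sort_le s; have := size_sort <=%R s.
move: (sort _ s) => t st tle.
case: ltP => [ak|ka]; apply/esym.
- have : (size (drop k t) <= count (> a) (drop k t))%N.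
    apply: eq_leq; apply/esym/eqP; rewrite -all_count.
    apply/(all_nthP 0) => i; rewrite size_drop nth_drop => ik.
    apply: (lt_le_trans ak); apply: tle.
    by rewrite -st leq_addr -ltn_subRL.
  rewrite size_drop leq_subLR -{3}(cat_take_drop k t) count_cat -st ltnS => h.
  by apply: (leq_trans h); rewrite leq_add2l leq_addl.
- apply/negbTE; rewrite -leqNgt -{1}(cat_take_drop k.+1 t) count_cat.
  have -> : count (> a) (take k.+1 t) = 0%N.
    apply/eqP; rewrite -leqn0 leqNgt -has_count; apply/hasPn => y.
    case/(nthP 0) => i; rewrite size_takel ?st// => ik <-.
    rewrite nth_take //= -leNgt; apply: le_trans ka; apply: tle.
    by apply/andP; split; lia.
  have := count_size (> a) (drop k.+1 t).
  by rewrite size_drop add0n st -(leq_add2l k.+1) subnKC.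
Qed.

Lemma order_statistic_mem s k : (0 < k <= size s)%N -> order_statistic s k \in s.
Proof.
case: k => // k ks; rewrite /order_statistic /= -(mem_sort <=%R).
by rewrite mem_nth ?size_sort.
Qed.

(** The terms of rank at least k are all bounded below by the k-th smallest. *)
Lemma order_statistic_le_sum s k : (0 < k <= size s)%N ->
  all (>= 0) s ->
  order_statistic s k * (size s - k).+1%:R <= \sum_(y <- s) y.
Proof.
case: k => // k ks s0; rewrite /order_statistic /=.
rewrite -(perm_big _ (permEl (perm_sort <=%R s))) /=.
have t0 : all (>= 0) (sort <=%R s) by rewrite all_sort.
have := @nth_sort_le s; have := size_sort <=%R s.
move: (sort _ s) t0 => t t0 st tle.
rewrite -(cat_take_drop k t) big_cat /= cat_take_drop.
have h1 : 0 <= \sum_(y <- take k t) y.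
  rewrite big_seq; apply: sumr_ge0 => y /mem_take yt.
  exact: (allP t0).
have h2 : nth 0 t k * (size (drop k t))%:R <= \sum_(y <- drop k t) y.
  rewrite mulr_natr -[X in _ *+ X]subn0 -sumr_const_nat [leRHS](big_nth 0).
  rewrite [leRHS]big_nat big_nat.
  apply: ler_sum => i ik; rewrite nth_drop; apply: tle.
  by move: ik; rewrite size_drop leq_addr -ltn_subRL -st => /andP[].
rewrite size_drop st in h2.
rewrite subnSK//.
by apply: (le_trans h2); rewrite lerDr.
Qed.

End OrderStatistics.

Section Spacings.
Context {R : realType}.
Variable u : seq R.
Implicit Types (k : nat) (a v : R).
Hypothesis u01 : all (fun v : R => 0 <= v <= 1) u.

Local Notation s := (sort <=%R u).
Local Notation e := (endpoints u).

Lemma size_spacings : size (spacings u) = (size u).+1.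
Proof. by rewrite size_map size_iota. Qed.

Lemma nth_spacings k : (k < (size u).+1)%N ->
  nth 0 (spacings u) k = nth 0 e k.+1 - nth 0 e k.
Proof. by move=> ku; rewrite (nth_map 0%N) ?size_iota// nth_iota. Qed.

Lemma nth_endpoints_last : nth 0 e (size u).+1 = 1.
Proof. by rewrite /= nth_rcons size_sort ltnn eqxx. Qed.

Lemma nth_endpoints_sort k : (k < size u)%N -> nth 0 e k.+1 = nth 0 s k.
Proof. by move=> ku; rewrite /= nth_rcons size_sort ku. Qed.

Lemma nth_sort01 k : (k < size u)%N -> 0 <= nth 0 s k <= 1.
Proof.
by move=> ku; apply: (allP u01); rewrite -(mem_sort <=%R) mem_nth// size_sort.
Qed.

Lemma nth_endpoints_le k : (k < (size u).+1)%N -> nth 0 e k <= nth 0 e k.+1.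
Proof.
case: k => [_|k].
- case: (posnP (size u)) => [u0|u0].
    by rewrite -[1%N]/(0.+1) -{2}u0 nth_endpoints_last.
  by rewrite nth_endpoints_sort// /=; case/andP: (nth_sort01 u0).
- rewrite ltnS => ku; rewrite nth_endpoints_sort//.
  move: ku; rewrite leq_eqVlt => /orP[/eqP ku|ku].
    by rewrite ku nth_endpoints_last; case/andP: (@nth_sort01 k ltac:(lia)).
  by rewrite nth_endpoints_sort//; apply: nth_sort_le; rewrite leqnSn.
Qed.

Lemma nth_endpoints_le1 k : (k < (size u).+2)%N -> 0 <= nth 0 e k <= 1.
Proof.
case: k => [_|k]; first by rewrite /= lexx ler01.
rewrite !ltnS leq_eqVlt => /orP[/eqP ->|ku].
  by rewrite nth_endpoints_last lexx ler01.
by rewrite nth_endpoints_sort// nth_sort01.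
Qed.

Lemma spacings_ge0 : all (>= 0) (spacings u).
Proof.
apply/(all_nthP 0) => k; rewrite size_spacings => ku.
by rewrite nth_spacings//= subr_ge0 nth_endpoints_le.
Qed.

Lemma sum_spacings : \sum_(y <- spacings u) y = 1.
Proof.
rewrite (big_nth 0) size_spacings.
rewrite (eq_big_nat _ _ (F2 := fun k => nth 0 e k.+1 - nth 0 e k)); last first.
  by move=> k /andP[_ ku]; rewrite nth_spacings.
by rewrite telescope_sumr// nth_endpoints_last subr0.
Qed.

(** No sample value lies strictly inside a spacing. *)
Lemma notin_spacing k v : (k < (size u).+1)%N -> v \in u ->
  v <= nth 0 e k \/ nth 0 e k.+1 <= v.
Proof.
move=> ku; rewrite -(mem_sort <=%R) => /(nthP 0)[l]; rewrite size_sort => lu <-.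
case: (leqP k l) => [kl|lk]; [right|left].
- rewrite nth_endpoints_sort; last exact: leq_ltn_trans kl lu.
  by apply: nth_sort_le; rewrite kl; exact: lu.
- case: k ku lk => // k ku lk.
  rewrite nth_endpoints_sort//; apply: nth_sort_le; rewrite -ltnS lk; exact: ku.
Qed.

(** v is followed by a gap longer than a, ties with v being disregarded. *)
Definition open_gap (a v : R) : bool :=
  (v + a < 1) && all (fun w : R => ~~ (v < w <= v + a)) u.

(** v is an untied sample value followed by a gap longer than a. *)
Definition closed_gap (a v : R) : bool :=
  (v + a < 1) && (count (fun w : R => (v <= w <= v + a)%R) u <= 1)%N.

Lemma count_iota_nth (p : pred R) :
  count p u = count (fun k => p (nth 0%R s k)) (iota 0 (size u)).
Proof.
rewrite -count_sort -{1}(mkseq_nth 0 s) /mkseq count_map size_sort.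
exact: eq_count.
Qed.

Lemma count_spacings (p : pred R) :
  count p (spacings u) = (p (nth 0 e 1 - nth 0 e 0)%R +
   count (fun k => p (nth 0 e k.+2 - nth 0 e k.+1)%R) (iota 0 (size u)))%N.
Proof.
rewrite /spacings count_map -[iota 1 _]/(1%N :: iota (2 + 0) (size u)).
by rewrite (iotaDl 2 0) /= count_map; congr addn; apply: eq_count.
Qed.

(** The gaps counted are those to the right of the sample values; the extra unit
    is the first spacing, to the right of 0. *)
Lemma count_spacings_le (a : R) :
  (count (> a) (spacings u) <= (count (open_gap a) u).+1)%N.
Proof.
rewrite count_spacings count_iota_nth -[leqRHS]add1n; apply: leq_add; first exact: leq_b1.
apply: sub_in_count => k; rewrite mem_iota add0n => /andP[_ ku].
rewrite -(@nth_endpoints_sort k)// -[X in X -> _]/(is_true (a < nth 0 e k.+2 - nth 0 e k.+1)).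
move=> ak; apply/andP; split.
  have /andP[_ h] := @nth_endpoints_le1 k.+2 ku.
  by lra.
apply/allP => w /(@notin_spacing k.+1 _ ku) h.
by apply/negP => /andP[h1 h2]; case: h => h; lra.
Qed.

Lemma le_count_spacings (a : R) :
  (count (closed_gap a) u <= count (> a) (spacings u))%N.
Proof.
rewrite count_spacings count_iota_nth; apply: leq_trans (leq_addl _ _).
apply: sub_in_count => k; rewrite mem_iota add0n => /andP[_ ku] /andP[va].
rewrite -[X in _ -> X]/(is_true (a < nth 0 e k.+2 - nth 0 e k.+1)).
rewrite (@nth_endpoints_sort k ku).
have [->|k1u] := eqVneq k.+1 (size u); first by rewrite nth_endpoints_last => _; lra.
have {}k1u : (k.+1 < size u)%N by rewrite ltn_neqAle k1u.
rewrite (@nth_endpoints_sort k.+1)//.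
have sk : nth 0 s k <= nth 0 s k.+1 by apply: nth_sort_le; rewrite leqnSn.
apply: contraTT; rewrite -leNgt -ltnNge => ska.
rewrite -count_sort; set p : pred R := fun w => _.
have p0 : p (nth 0 s k) by rewrite /p; apply/andP; split; lra.
have p1 : p (nth 0 s k.+1) by rewrite /p; apply/andP; split; lra.
move: p p0 p1 => p p0 p1.
rewrite -(cat_take_drop k s) count_cat (drop_nth 0) ?size_sort//.
rewrite (drop_nth 0) ?size_sort//=.
by rewrite p0 p1 !add1n addnS ltnS addnS.
Qed.

(** A spacing longer than two cells of the regular grid contains a cell, which is
    then free of sample values. *)
Lemma empty_cell M k : (0 < M)%N -> (0 < k <= (size u).+1)%N ->
  2 / M%:R < order_statistic (spacings u) k ->
  exists c : 'I_M, all (fun w : R => ~~ (c%:R / M%:R <= w < c.+1%:R / M%:R)) u.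
Proof.
move=> M0 ku; have := @order_statistic_mem _ (spacings u) k.
rewrite size_spacings => /(_ ku) /(nthP 0)[l].
rewrite size_spacings => lu <-; rewrite nth_spacings// => big.
have /andP[l0 _] := @nth_endpoints_le1 l (leqW lu).
have /andP[_ l1] := @nth_endpoints_le1 l.+1 lu.
have M0' : 0 < M%:R :> R by rewrite ltr0n.
have [t /andP[tl tr]] : exists t, t%:R <= nth 0 e l * M%:R < t.+1%:R.
  by eexists; apply: truncn_itv; rewrite mulr_ge0// ltW.
have cr : t.+2%:R / M%:R < nth 0 e l.+1.
  rewrite ltr_pdivrMr//; move: big; rewrite ltr_pdivrMr// mulrBl => big.
  by rewrite -[t.+2]addn2 natrD; lra.
have cl : nth 0 e l < t.+1%:R / M%:R by rewrite ltr_pdivlMr.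
have cM : (t.+1 < M)%N.
  by have := lt_le_trans cr l1; rewrite ltr_pdivrMr// mul1r ltr_nat; apply: ltnW.
exists (Ordinal cM); apply/allP => w /(notin_spacing lu) h.
by apply/negP => /andP[/= h1 h2]; case: h => h; lra.
Qed.

End Spacings.
(** * Means of linear combinations of events *)

Section Events.
Context {R : realType} {d : measure_display} {T : measurableType d}.
Variable P : probability T R.
Local Notation mf := (measurable_fun [set: T]).

(** The real-valued probability of an event given by its boolean characteristic function. *)
Definition event_prob (b : T -> bool) : R := fine (P [set t | b t]).

(** The real-valued expectation; it is 0 when the integral is not finite. *)
Definition mean (X : T -> R) : R := fine ('E_P[X])%E.

(** Events are handled through measurable boolean functions. *)
Lemma measurable_event (b : T -> bool) : mf b -> measurable [set t | b t].
Proof.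
move=> mb; rewrite (_ : [set t | b t] = setT `&` b @^-1` [set true]).
  exact: mb.
by rewrite setTI.
Qed.

Lemma measurable_natb (b : T -> bool) : mf b -> mf (fun t => (b t)%:R : R).
Proof.
move=> mb; rewrite (_ : (fun t => _) = (fun t => if b t then 1 else 0 : R)).
  exact: measurable_fun_ifT.
by apply/funext => t; case: (b t).
Qed.

Lemma measurable_forall (I : finType) (b : I -> T -> bool) :
  (forall i, mf (b i)) -> mf (fun t => [forall i, b i t]).
Proof.
move=> mb; rewrite (_ : (fun t => _) = fun t => \big[andb/true]_i b i t).
  elim: (index_enum I) => [|i s IH].
    by under eq_fun do rewrite big_nil; exact: measurable_cst.
  by under eq_fun do rewrite big_cons; exact: measurable_and.
by apply/funext => t; rewrite big_andE.
Qed.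

Lemma mean_natb (b : T -> bool) : mf b -> mean (fun t => (b t)%:R) = event_prob b.
Proof.
move=> mb; rewrite /mean unlock /event_prob.
rewrite (_ : (fun t => _) = fun t => (\1_[set t | b t] t)%:E).
  by rewrite integral_indic// ?setIT//; exact: measurable_event.
apply/funext => t /=; rewrite indicE; congr (_%:R%:E).
by case: (boolP (b t)) => bt; [rewrite mem_set|rewrite memNset//; apply/negP].
Qed.

Lemma integrable_bounded (X : T -> R) (B : R) : mf X ->
  (forall t, `|X t| <= B) -> P.-integrable setT (EFin \o X).
Proof.
move=> mX XB; apply: measurable_bounded_integrable => //.
  exact: le_lt_trans (probability_le1 P measurableT) (ltry 1).
exists B; split; first exact: num_real.
by move=> y By t _ /=; apply: le_trans (XB t) (ltW By).
Qed.

Lemma meanE (X : T -> R) : mean X = \int[P]_t X t.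
Proof. by rewrite /mean unlock. Qed.

Lemma measurable_comb (I : Type) (s : seq I) (c : I -> R) (b : I -> T -> bool) :
  (forall i, mf (b i)) -> mf (fun t => \sum_(i <- s) c i * (b i t)%:R).
Proof.
move=> mb; apply: measurable_sum => i; apply: measurable_funM => //.
exact: measurable_natb.
Qed.

Lemma comb_bounded (I : Type) (s : seq I) (c : I -> R) (b : I -> T -> bool) t :
  `|\sum_(i <- s) c i * (b i t)%:R| <= \sum_(i <- s) `|c i|.
Proof.
apply: le_trans (ler_norm_sum _ _ _) _; apply: ler_sum => i _.
by rewrite normrM ler_piMr// ger0_norm// lern1 leq_b1.
Qed.

Lemma mean_sum (I : finType) (c : I -> R) (b : I -> T -> bool) :
  (forall i, mf (b i)) ->
  mean (fun t => \sum_i c i * (b i t)%:R) = \sum_i c i * event_prob (b i).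
Proof.
move=> mb.
have ib i : P.-integrable setT (EFin \o (fun t => (b i t)%:R : R)).
  apply: (@integrable_bounded _ 1); first exact: measurable_natb.
  by move=> t; rewrite ger0_norm// lern1 leq_b1.
have icb i : P.-integrable setT (EFin \o (fun t => c i * (b i t)%:R)).
  rewrite (_ : _ \o _ = fun t => ((c i)%:E * (EFin \o (fun t => (b i t)%:R : R)) t)%E).
    exact: integrableZl.
  by apply/funext => t.
rewrite meanE; elim: (index_enum I) => [|i s IH].
  by under eq_Rintegral do rewrite big_nil; rewrite big_nil Rintegral_cst// mul0r.
under eq_Rintegral do rewrite big_cons.
rewrite RintegralD//.
  by rewrite IH big_cons RintegralZl// -meanE mean_natb.
apply: (@integrable_bounded _ (\sum_(i <- s) `|c i|)); first exact: measurable_comb.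
by move=> t; exact: comb_bounded.
Qed.

Lemma prob_le1 b : mf b -> event_prob b <= 1.
Proof.
move=> mb; rewrite /event_prob -[1]/(fine 1%E) fine_le//.
  exact/fin_num_measure/measurable_event.
by apply: probability_le1; exact: measurable_event.
Qed.

Lemma event_probT : event_prob (fun=> true) = 1.
Proof.
rewrite /event_prob (_ : [set _ | _] = setT); last by apply/seteqP; split.
by rewrite [X in fine X](@probability_setT _ _ _ P).
Qed.

Variable D : T -> bool.
Hypotheses (mD : mf D) (D1 : event_prob D = 1).

(** The complement of an almost sure event does not contribute to the mean. *)
Lemma mean_restrict (X : T -> R) : mf X -> mean X = \int[P]_(t in [set t | D t]) X t.
Proof.
have mD' := measurable_event mD.
move=> mX; rewrite meanE /Rintegral [in RHS]integral_mkcond; congr fine.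
apply: ae_eq_integral => //.
- exact/measurable_EFinP.
- by apply/(measurable_restrictT _ mD'); apply: measurable_funTS; exact/measurable_EFinP.
- exists (~` [set t | D t]); split; first exact: measurableC.
    have : P [set t | D t] = 1%E.
      by rewrite -[LHS]fineK ?fin_num_measure//; congr EFin.
    by move=> PD; rewrite [LHS](probability_setC P mD') PD subee.
  move=> t /= nt Dt; apply: nt => _.
  by rewrite /patch mem_set.
Qed.

(** Monotonicity of the mean under an almost sure inequality. *)
Lemma le_mean (X Y : T -> R) (B : R) : mf X -> mf Y ->
  (forall t, D t -> `|X t| <= B) -> (forall t, D t -> `|Y t| <= B) ->
  (forall t, D t -> X t <= Y t) -> mean X <= mean Y.
Proof.
move=> mX mY XB YB XY; rewrite !mean_restrict//.
have mD' := measurable_event mD.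
have itg (Z : T -> R) : mf Z -> (forall t, D t -> `|Z t| <= B) ->
    P.-integrable [set t | D t] (EFin \o Z).
  move=> mZ ZB; apply: measurable_bounded_integrable => //.
  - exact: le_lt_trans (probability_le1 P mD') (ltry 1).
  - exact: measurable_funTS.
  - exists B; split; first exact: num_real.
    by move=> y By t Dt /=; apply: le_trans (ZB _ Dt) (ltW By).
by apply: le_Rintegral => //; exact: itg.
Qed.

(** An almost sure inequality between linear combinations of indicators passes
    to the probabilities. *)
Lemma le_comb_prob (I J : finType) (c : I -> R) (b : I -> T -> bool)
    (c' : J -> R) (b' : J -> T -> bool) :
  (forall i, mf (b i)) -> (forall j, mf (b' j)) ->
  (forall t, D t -> \sum_i c i * (b i t)%:R <= \sum_j c' j * (b' j t)%:R) ->
  \sum_i c i * event_prob (b i) <= \sum_j c' j * event_prob (b' j).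
Proof.
move=> mb mb' h; rewrite -!mean_sum//.
apply: (@le_mean _ _ (Num.max (\sum_i `|c i|) (\sum_j `|c' j|))) => //.
- exact: measurable_comb.
- exact: measurable_comb.
- by move=> t _; rewrite le_max comb_bounded.
- by move=> t _; rewrite le_max comb_bounded orbT.
Qed.

Lemma prob_le_sum (I : finType) (b : T -> bool) (b' : I -> T -> bool) :
  mf b -> (forall i, mf (b' i)) ->
  (forall t, D t -> b t -> exists i, b' i t) ->
  event_prob b <= \sum_i event_prob (b' i).
Proof.
move=> mb mb' h.
have -> : event_prob b = \sum_(i : unit) 1 * event_prob b.
  by rewrite big_const card_unit /= mul1r addr0.
under [leRHS]eq_bigr do rewrite -[event_prob _]mul1r.
apply: le_comb_prob => // t Dt.
rewrite big_const card_unit /= mul1r addr0.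
under [leRHS]eq_bigr do rewrite mul1r.
case: (boolP (b t)) => [bt|_]; last exact: sumr_ge0.
have [i it] := h t Dt bt.
by rewrite (bigD1 i)//= it lerDl sumr_ge0.
Qed.

Lemma le_prob (b b' : T -> bool) : mf b -> mf b' ->
  (forall t, D t -> b t -> b' t) -> event_prob b <= event_prob b'.
Proof.
move=> mb mb' h.
have := @prob_le_sum unit b (fun=> b') mb (fun=> mb').
rewrite big_const card_unit /= addr0; apply => t Dt /(h t Dt) bt.
by exists tt.
Qed.

Lemma sum_le_prob (I : finType) (b : T -> bool) (b' : I -> T -> bool) :
  mf b -> (forall i, mf (b' i)) ->
  (forall t i, D t -> b' i t -> b t) ->
  (forall t i j, b' i t -> b' j t -> i = j) ->
  \sum_i event_prob (b' i) <= event_prob b.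
Proof.
move=> mb mb' h disj.
have -> : event_prob b = \sum_(i : unit) 1 * event_prob b.
  by rewrite big_const card_unit /= mul1r addr0.
under eq_bigr do rewrite -[event_prob _]mul1r.
apply: le_comb_prob => // t Dt.
rewrite [leRHS]big_const card_unit /= mul1r addr0.
under eq_bigr do rewrite mul1r.
case: (pickP (b'^~ t)) => [i it|none]; last first.
  by rewrite big1// => i _; rewrite none.
rewrite (bigD1 i)//= big1 ?addr0 ?it ?(h _ _ Dt it)// => j ji.
by case: (boolP (b' j t)) => // jt; rewrite (disj _ _ _ jt it) eqxx in ji.
Qed.

End Events.
(** * Probabilities of gap events of a uniform sample *)

Section Uniform.
Context {R : realType}.

Lemma measurable_itv_pred (a b : R) :
  measurable_fun [set: R] (fun v => a <= v < b).
Proof. by apply: measurable_and; apply: measurable_fun_ler || apply: measurable_fun_ltr. Qed.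

Let unif := event_prob (uniform_prob (@ltr01 R)).

Lemma uniform_itv (a b : R) : 0 <= a -> a <= b -> b <= 1 ->
  unif (fun v => a <= v < b) = b - a.
Proof.
move=> a0 ab b1; rewrite /unif /event_prob /= /uniform_prob.
have -> : [set v | a <= v < b] = `[a, b[%classic.
  by apply/seteqP; split => v /=; rewrite in_itv.
rewrite (eq_integral (cst 1%E)); last first.
  move=> v; rewrite inE /= in_itv /= => /andP[av vb]; rewrite /uniform_pdf.
  by rewrite (le_trans a0 av) (le_trans (ltW vb) b1) subr0 invr1.
rewrite integral_cst//= mul1e lebesgue_measure_itv/= lte_fin.
case: ltP => //= ba; have -> : a = b by apply/eqP; rewrite eq_le ab.
by rewrite subrr.
Qed.

Lemma uniform_not_itv (a b : R) : 0 <= a -> a <= b -> b <= 1 ->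
  unif (fun v => ~~ (a <= v < b)) = 1 - (b - a).
Proof.
move=> a0 ab b1; rewrite -(uniform_itv a0 ab b1) /unif /event_prob.
have mA := measurable_event (measurable_itv_pred a b).
rewrite (_ : [set v | ~~ (a <= v < b)] = ~` [set v | a <= v < b]); last first.
  by apply/seteqP; split => v /= /negP.
rewrite [X in fine X](probability_setC (uniform_prob (@ltr01 R)) mA).
by rewrite fineB// fin_num_measure.
Qed.

Lemma uniform_not_itv2 (a b a' b' : R) :
  0 <= a -> a <= b -> b <= a' -> a' <= b' -> b' <= 1 ->
  unif (fun v => ~~ (a <= v < b) && ~~ (a' <= v < b')) = 1 - (b - a) - (b' - a').
Proof.
move=> a0 ab ba' ab' b1.
have mA := measurable_itv_pred a b; have mA' := measurable_itv_pred a' b'.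
pose B (k : 'I_2) v := if k == 0 then ~~ (a <= v < b) else a' <= v < b'.
have mB k : measurable_fun [set: R] (B k).
  by rewrite /B; case: (k == 0) => //; exact: measurable_neg.
pose c (k : 'I_2) : R := if k == 0 then 1 else -1.
transitivity (mean (uniform_prob (@ltr01 R)) (fun v => \sum_k c k * (B k v)%:R)).
  rewrite /unif -mean_natb; last by apply: measurable_and; exact: measurable_neg.
  congr (mean _ _); apply/funext => v.
  rewrite big_ord_recl big_ord1 /c /B /= mul1r mulN1r.
  case: (boolP (a <= v < b)) => [/andP[av vb]|_];
    case: (boolP (a' <= v < b')) => [/andP[av' vb']|_] //=; lra.
rewrite mean_sum// big_ord_recl big_ord1 /c /B /= -/unif.
by rewrite uniform_not_itv ?uniform_itv ?mul1r ?mulN1r//; lra.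
Qed.

End Uniform.
Section Sample.
Context {R : realType} {d : measure_display} {T : measurableType d}.
Context {P : probability T R} {m : nat}.
Variable U : 'I_m -> {RV P >-> R}.
Hypothesis hU : uniform01_sample U.
Local Notation mf := (measurable_fun [set: T]).
Local Notation prob := (event_prob P).
Local Notation unif := (event_prob (uniform_prob (@ltr01 R))).

(** Independence, for a product set with sides of known lengths. *)
Lemma prob_box (A : 'I_m -> R -> bool) (w : 'I_m -> R) :
  (forall i, measurable_fun [set: R] (A i)) ->
  (forall i, unif (A i) = w i) ->
  prob (fun t => [forall i, A i (U i t)]) = \prod_i w i.
Proof.
move=> mA Aw; rewrite /event_prob.
have [/(_ [set: 'I_m]%SET (fun i => [set v | A i v])) ind dist] := hU.
rewrite (_ : [set t | _] =
    \bigcap_(i in [set` [set: 'I_m]%SET]) (U i @^-1` [set v | A i v])); last first.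
  apply/seteqP; split => [t /forallP At i _ /=|t At]; first exact: At.
  by apply/forallP => i; apply: At; rewrite /= inE.
rewrite ind => [|i]; last exact: measurable_event.
rewrite (eq_bigr (fun i => (w i)%:E)) => [|i _]; last first.
  have mAi : measurable [set v | A i v] by exact: measurable_event.
  have fA := fin_num_measure (uniform_prob (@ltr01 R)) _ mAi.
  by rewrite -Aw /event_prob fineK//; exact: (dist i _ mAi).
by rewrite prodEFin /=; apply: eq_bigl => i; rewrite inE.
Qed.

(** Almost surely all the points lie in [0, 1[. *)
Definition in_unit_interval t := [forall i, 0 <= U i t < 1].

Lemma measurable_in_unit_interval : mf in_unit_interval.
Proof.
apply: measurable_forall => i.
by apply: measurable_and; [apply: measurable_fun_ler|apply: measurable_fun_ltr].
Qed.

(** The point i is followed by a gap longer than a, ties with it being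
    disregarded. *)
Definition open_gap_event (a : R) i t : bool :=
  (U i t + a < 1) && [forall j, ~~ (U i t < U j t <= U i t + a)].

(** The point i is untied and followed by a gap longer than a. *)
Definition closed_gap_event (a : R) i t : bool :=
  (U i t + a < 1) && [forall j, (j != i) ==> ~~ (U i t <= U j t <= U i t + a)].

Lemma closed_gap_open a i t : closed_gap_event a i t -> open_gap_event a i t.
Proof.
move=> /andP[Ui /forallP ci]; rewrite /open_gap_event Ui.
apply/forallP => j; have [->|ji] := eqVneq j i; first by rewrite ltxx.
by have := ci j; rewrite ji; apply: contraNN => /andP[/ltW -> ->].
Qed.

Lemma measurable_open_gap_event a i : mf (open_gap_event a i).
Proof.
have mUa : mf (fun t => U i t + a) by apply: measurable_funD.
apply: measurable_and; first exact: measurable_fun_ltr.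
apply: measurable_forall => j; apply: measurable_neg; apply: measurable_and.
  exact: measurable_fun_ltr.
exact: measurable_fun_ler.
Qed.

Lemma measurable_closed_gap_event a i : mf (closed_gap_event a i).
Proof.
have mUa : mf (fun t => U i t + a) by apply: measurable_funD.
apply: measurable_and; first exact: measurable_fun_ltr.
apply: measurable_forall => j; case: (j != i) => /=; last exact: measurable_cst.
apply: measurable_neg; apply: measurable_and; exact: measurable_fun_ler.
Qed.

Lemma prob_in_unit_interval : prob in_unit_interval = 1.
Proof.
rewrite /in_unit_interval (prob_box (A := fun _ v => 0 <= v < 1) (w := fun=> 1)).
- by rewrite big1.
- by move=> i; exact: measurable_itv_pred.
- by move=> i; rewrite uniform_itv ?subr0.
Qed.

(** The c-th cell of the regular subdivision of [0, 1[ into M cells. *)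
Definition in_cell (M c : nat) (v : R) : bool := c%:R / M%:R <= v < c.+1%:R / M%:R.

Lemma in_cell_inj M (c c' : nat) v : (0 < M)%N ->
  in_cell M c v -> in_cell M c' v -> c = c'.
Proof.
move=> M0; have M0' : 0 < M%:R :> R by rewrite ltr0n.
move=> /andP[h1 h2] /andP[h3 h4].
have := le_lt_trans h1 h4; have := le_lt_trans h3 h2.
by rewrite !ltr_pM2r ?invr_gt0// !ltr_nat; lia.
Qed.

Lemma in_cell_lt M (c c' : nat) v v' : (0 < M)%N -> (c < c')%N ->
  in_cell M c v -> in_cell M c' v' -> v < v'.
Proof.
move=> M0 cc' /andP[_ h2] /andP[h3 _].
apply: (lt_le_trans h2); apply: le_trans h3.
by rewrite ler_pM2r ?invr_gt0 ?ltr0n// ler_nat.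
Qed.

Lemma exists_in_cell M v : (0 < M)%N -> 0 <= v < 1 -> exists c : 'I_M, in_cell M c v.
Proof.
move=> M0 /andP[v0 v1]; have M0' : 0 < M%:R :> R by rewrite ltr0n.
have [c /andP[cl cr]] : exists c, c%:R <= v * M%:R < c.+1%:R.
  by eexists; apply: truncn_itv; rewrite mulr_ge0// ltW.
have cM : (c < M)%N.
  by rewrite -(@ltr_nat R); apply: (le_lt_trans cl); rewrite gtr_pMl.
by exists (Ordinal cM); rewrite /in_cell ler_pdivrMr// ltr_pdivlMr// cl.
Qed.

Lemma measurable_in_cell M c : measurable_fun [set: R] (in_cell M c).
Proof. exact: measurable_itv_pred. Qed.

Lemma cell_le1 (M c : nat) : (c < M)%N -> c.+1%:R / M%:R <= 1 :> R.
Proof.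
by move=> cM; rewrite ler_pdivrMr ?mul1r ?ler_nat// ltr0n; exact: leq_trans cM.
Qed.

Lemma cell_length (M c : nat) : c.+1%:R / M%:R = c%:R / M%:R + M%:R^-1 :> R.
Proof. by rewrite -natr1 mulrDl mul1r. Qed.

Lemma uniform_in_cell M c : (c < M)%N -> unif (in_cell M c) = M%:R^-1.
Proof.
move=> cM; rewrite uniform_itv ?cell_le1//.
- by rewrite cell_length addrAC subrr add0r.
- by rewrite cell_length lerDl invr_ge0.
Qed.

(** The probability that a given cell contains no point. *)
Lemma prob_empty_cell M c : (c < M)%N ->
  prob (fun t => [forall i, ~~ in_cell M c (U i t)]) = (1 - M%:R^-1) ^+ m.
Proof.
move=> cM.
rewrite (prob_box (A := fun _ v => ~~ in_cell M c v) (w := fun=> 1 - M%:R^-1)).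
- by rewrite prodr_const card_ord.
- by move=> i; apply: measurable_neg; exact: measurable_in_cell.
- move=> i; rewrite uniform_not_itv ?cell_le1//.
  + by rewrite cell_length addrAC subrr add0r.
  + by rewrite cell_length lerDl invr_ge0.
Qed.

Lemma prodr_except1 (i : 'I_m) (x y : R) :
  \prod_j (if j == i then x else y) = x * y ^+ m.-1.
Proof.
rewrite (bigD1 i)//= eqxx; congr (_ * _).
rewrite (eq_bigr (fun=> y)) => [|j /negbTE -> //].
by rewrite prodr_const cardC1 card_ord.
Qed.

Lemma prodr_except2 (i j : 'I_m) (x y z : R) : i != j ->
  \prod_l (if l == i then x else if l == j then y else z) = x * y * z ^+ m.-2.
Proof.
move=> ij; rewrite (bigD1 i)//= eqxx (bigD1 j)/=; last by rewrite eq_sym.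
rewrite eqxx [j == i]eq_sym (negbTE ij) -mulrA; congr (_ * (_ * _)).
rewrite (eq_bigr (fun=> z)) => [|l /andP[/negbTE -> /negbTE ->]//].
rewrite prodr_const; congr (_ ^+ _).
have := cardsC [set i; j]%SET; rewrite cards2 ij card_ord => /(canRL (addKn _)) cC.
rewrite -subn2 -[RHS]cC; apply: eq_card => l.
by rewrite !inE negb_or.
Qed.

(** Lower bound for the probability of a gap, from the cell of its left end. *)
Lemma prob_closed_gap_ge M a i : (0 < M)%N -> 0 <= a -> a + M%:R^-1 <= 1 ->
  (1 - a - M%:R^-1) ^+ m <= prob (closed_gap_event a i).
Proof.
move=> M0 a0 aM; have M0' : 0 < M%:R :> R by rewrite ltr0n.
set q := 1 - a - M%:R^-1; have q0 : 0 <= q by rewrite /q; lra.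
have Mi : 0 < M%:R^-1 :> R by rewrite invr_gt0.
have [K /andP[Kl Kr]] : exists K, K%:R <= (1 - a) * M%:R < K.+1%:R.
  by eexists; apply: truncn_itv; rewrite mulr_ge0//; lra.
have KM : (K <= M)%N.
  by rewrite -(@ler_nat R); apply: (le_trans Kl); rewrite ger_pMl//; lra.
pose A c (j : 'I_m) v := if j == i then in_cell M c v
  else ~~ (c%:R / M%:R <= v < c.+1%:R / M%:R + a).
have mA c j : measurable_fun [set: R] (A c j).
  rewrite /A; case: (j == i); first exact: measurable_in_cell.
  by apply: measurable_neg; exact: measurable_itv_pred.
have cK (c : 'I_K) : c.+1%:R / M%:R + a <= 1.
  rewrite -lerBrDr ler_pdivrMr//; apply: le_trans Kl; by rewrite ler_nat.
have cM (c : 'I_K) : (c < M)%N by exact: leq_trans KM.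
have PA (c : 'I_K) :
    prob (fun t => [forall j, A c j (U j t)]) = M%:R^-1 * q ^+ m.-1.
  rewrite (prob_box (w := fun j => if j == i then M%:R^-1 else q))//.
    exact: prodr_except1.
  move=> j; rewrite /A; case: (j == i); first by rewrite uniform_in_cell.
  rewrite uniform_not_itv//.
  - by rewrite cell_length /q; lra.
  - by rewrite cell_length; lra.
apply: (@le_trans _ _ (\sum_(c < K) (M%:R^-1 * q ^+ m.-1))).
  rewrite sumr_const card_ord -[leRHS]mulr_natr.
  have -> : q ^+ m = q * q ^+ m.-1.
    by rewrite -exprS prednK//; exact: leq_ltn_trans (ltn_ord i).
  rewrite [leRHS]mulrAC ler_wpM2r ?exprn_ge0//.
  rewrite [leRHS]mulrC ler_pdivlMr// /q mulrBl mulVf ?gt_eqF// lerBlDr natr1; exact: ltW.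
under eq_bigr => c _ do rewrite -(PA c).
apply: (sum_le_prob measurable_in_unit_interval prob_in_unit_interval).
- exact: measurable_closed_gap_event.
- move=> c; apply: measurable_forall => j.
  exact: measurableT_comp (mA c j) _.
- move=> t c _ /forallP At; have := At i; rewrite /A eqxx => /andP[cl cr].
  apply/andP; split; first by have := cK c; lra.
  apply/forallP => j; apply/implyP => ji; have := At j; rewrite /A (negbTE ji).
  by apply: contraNN => /andP[h1 h2]; apply/andP; split; lra.
- move=> t c c' /forallP/(_ i) h /forallP/(_ i) h'; apply/val_inj.
  by move: h h'; rewrite /A eqxx; exact: in_cell_inj.
Qed.

Lemma prob_two_cells M (c c' : nat) i j : i != j -> (c < M)%N -> (c' < M)%N ->
  prob (fun t => in_cell M c (U i t) && in_cell M c' (U j t)) <= M%:R^-1 * M%:R^-1.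
Proof.
move=> ij cM c'M.
pose A l v := if l == i then in_cell M c v else if l == j then in_cell M c' v else true.
have mA l : measurable_fun [set: R] (A l).
  rewrite /A; case: (l == i); first exact: measurable_in_cell.
  by case: (l == j); [exact: measurable_in_cell|exact: measurable_cst].
have PA : prob (fun t => [forall l, A l (U l t)]) = M%:R^-1 * M%:R^-1.
  rewrite (prob_box
    (w := fun l => if l == i then M%:R^-1 else if l == j then M%:R^-1 else 1))//.
    by rewrite prodr_except2// expr1n mulr1.
  move=> l; rewrite /A; case: (l == i); first by rewrite uniform_in_cell.
  case: (l == j); first by rewrite uniform_in_cell.
  exact: event_probT.
rewrite -PA; apply: (le_prob measurable_in_unit_interval prob_in_unit_interval).
- by apply: measurable_and; exact: measurableT_comp (measurable_in_cell _ _) _.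
- by apply: measurable_forall => l; exact: measurableT_comp (mA l) _.
- move=> t _ /andP[ci cj]; apply/forallP => l; rewrite /A.
  by case: eqP => [->//|_]; case: eqP => [->//|].
Qed.

(** All the other points avoid two disjoint intervals of length a - 1 / M. *)
Lemma prob_two_cells_gaps M (c c' : nat) a i j : i != j ->
  (c < c')%N -> (c' < M)%N -> M%:R^-1 <= a -> a <= 2^-1 ->
  prob (fun t => [&& in_cell M c (U i t), in_cell M c' (U j t),
                     open_gap_event a i t & open_gap_event a j t]) <=
  M%:R^-1 * M%:R^-1 * (1 - 2 * a + 2 / M%:R) ^+ m.-2.
Proof.
move=> ij cc' c'M Ma a2; have M0 : (0 < M)%N by lia.
have M0' : 0 < M%:R :> R by rewrite ltr0n.
set q := 1 - 2 * a + 2 / M%:R.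
have Mi : 0 < M%:R^-1 :> R by rewrite invr_gt0.
have q0 : 0 <= q by rewrite /q; lra.
set b := fun t => _.
have mb : mf b.
  apply: measurable_and; first exact: measurableT_comp (measurable_in_cell _ _) _.
  apply: measurable_and; first exact: measurableT_comp (measurable_in_cell _ _) _.
  by apply: measurable_and; exact: measurable_open_gap_event.
have [[t Dt bt]|none] := pselect (exists2 t, in_unit_interval t & b t); last first.
  (* The event is almost surely empty. *)
  apply: (@le_trans _ _ 0); last by rewrite !mulr_ge0// ?exprn_ge0// ltW.
  have := @prob_le_sum _ _ _ P _ measurable_in_unit_interval prob_in_unit_interval
    'I_0 b (fun _ _ => false) mb.
  rewrite big_ord0; apply; first by case.
  by move=> t Dt bt; case: none; exists t.
have [ci cj /andP[i1 _ ] _] := and4P bt.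
have [_ _ /andP[_ /forallP/(_ j) Uij] /andP[j1 _]] := and4P bt.
rewrite (in_cell_lt M0 cc' ci cj)/= -ltNge in Uij.
have /andP[ci1 ci2] := ci; have /andP[cj1 cj2] := cj.
have c1 := cell_length M c; have c1' := cell_length M c'.
pose A l v := if l == i then in_cell M c v else if l == j then in_cell M c' v else
  ~~ (c.+1%:R / M%:R <= v < c%:R / M%:R + a) &&
  ~~ (c'.+1%:R / M%:R <= v < c'%:R / M%:R + a).
have mA l : measurable_fun [set: R] (A l).
  rewrite /A; case: (l == i); first exact: measurable_in_cell.
  case: (l == j); first exact: measurable_in_cell.
  by apply: measurable_and; apply: measurable_neg; exact: measurable_itv_pred.
have PA : prob (fun t => [forall l, A l (U l t)]) = M%:R^-1 * M%:R^-1 * q ^+ m.-2.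
  rewrite (prob_box
    (w := fun l => if l == i then M%:R^-1 else if l == j then M%:R^-1 else q))//.
    by rewrite prodr_except2.
  move=> l; rewrite /A; case: (l == i).
    by rewrite uniform_in_cell//; exact: ltn_trans c'M.
  case: (l == j); first by rewrite uniform_in_cell.
  rewrite uniform_not_itv2.
  - by rewrite /q c1 c1'; lra.
  - by rewrite divr_ge0.
  - by rewrite c1; lra.
  - by lra.
  - by rewrite c1'; lra.
  - by lra.
rewrite -PA; apply: (le_prob measurable_in_unit_interval prob_in_unit_interval) => //.
  by apply: measurable_forall => l; exact: measurableT_comp (mA l) _.
move=> {t Dt bt ci cj i1 j1 Uij ci1 ci2 cj1 cj2} t _.
move=> /and4P[ci cj /andP[_ /forallP gi] /andP[_ /forallP gj]].
apply/forallP => l; rewrite /A; case: eqP => [->//|_]; case: eqP => [->//|_].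
have /andP[ci1 ci2] := ci; have /andP[cj1 cj2] := cj.
apply/andP; split.
- by apply: contraNN (gi l) => /andP[h1 h2]; apply/andP; split; lra.
- by apply: contraNN (gj l) => /andP[h1 h2]; apply/andP; split; lra.
Qed.

(** Upper bound for the joint probability of two gaps, from the cells of their
    left ends; the term 1 / M accounts for two ends in the same cell. *)
Lemma prob_open_gap_pair M a i j : i != j -> (0 < M)%N ->
  M%:R^-1 <= a -> a <= 2^-1 ->
  prob (fun t => open_gap_event a i t && open_gap_event a j t) <=
  M%:R^-1 + (1 - 2 * a + 2 / M%:R) ^+ m.-2.
Proof.
move=> ij M0 Ma a2; have M0' : 0 < M%:R :> R by rewrite ltr0n.
set q := 1 - 2 * a + 2 / M%:R.
have Mi : 0 < M%:R^-1 :> R by rewrite invr_gt0.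
have q0 : 0 <= q by rewrite /q; lra.
pose b (p : 'I_M * 'I_M) t := [&& in_cell M p.1 (U i t), in_cell M p.2 (U j t),
                     open_gap_event a i t & open_gap_event a j t].
have mb p : mf (b p).
  apply: measurable_and; first exact: measurableT_comp (measurable_in_cell _ _) _.
  apply: measurable_and; first exact: measurableT_comp (measurable_in_cell _ _) _.
  by apply: measurable_and; exact: measurable_open_gap_event.
apply: (@le_trans _ _ (\sum_p prob (b p))).
  apply: (prob_le_sum measurable_in_unit_interval prob_in_unit_interval) => //.
    by apply: measurable_and; exact: measurable_open_gap_event.
  move=> t /forallP Dt /andP[gi gj].
  have [c ci] := exists_in_cell M0 (Dt i); have [c' cj] := exists_in_cell M0 (Dt j).
  by exists (c, c'); rewrite /b/= ci cj gi.
have bound (p : 'I_M * 'I_M) :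
    prob (b p) <= M%:R^-1 * M%:R^-1 * ((p.1 == p.2)%:R + q ^+ m.-2).
  case: p => c c'; rewrite /b/=; have [<-|cc'] := eqVneq c c'.
    apply: (@le_trans _ _ (M%:R^-1 * M%:R^-1)).
      apply: le_trans (prob_two_cells ij (ltn_ord c) (ltn_ord c)).
      apply: (le_prob measurable_in_unit_interval prob_in_unit_interval).
      - exact: (mb (c, c)).
      - by apply: measurable_and; exact: measurableT_comp (measurable_in_cell _ _) _.
      - by move=> t _ /and3P[-> ->].
    by rewrite ler_pMr ?mulr_gt0// lerDl exprn_ge0.
  rewrite add0r; case: (ltngtP c c') => [lt|lt|/val_inj eq]; last by rewrite eq eqxx in cc'.
  - exact: prob_two_cells_gaps.
  - have ji : j != i by rewrite eq_sym.
    apply: le_trans (prob_two_cells_gaps ji lt (ltn_ord c) Ma a2).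
    apply: (le_prob measurable_in_unit_interval prob_in_unit_interval).
    + exact: (mb (c, c')).
    + apply: measurable_and; first exact: measurableT_comp (measurable_in_cell _ _) _.
      apply: measurable_and; first exact: measurableT_comp (measurable_in_cell _ _) _.
      by apply: measurable_and; exact: measurable_open_gap_event.
    + by move=> t _ /and4P[-> -> -> ->].
apply: le_trans (ler_sum _ (fun p _ => bound p)) _.
rewrite -mulr_sumr big_split/= sumr_const card_prod card_ord.
have -> : \sum_(p : 'I_M * 'I_M) (p.1 == p.2)%:R = M%:R :> R.
  rewrite -(pair_big xpredT xpredT (fun c c' : 'I_M => (c == c')%:R : R))/=.
  rewrite (eq_bigr (fun=> 1)) => [|c _]; first by rewrite sumr_const card_ord.
  by rewrite (bigD1 c)//= eqxx big1 ?addr0// => c'; rewrite eq_sym => /negbTE ->.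
rewrite -[q ^+ _ *+ _]mulr_natr natrM mulrDr mulrA mulfVK ?gt_eqF//.
rewrite lerD2l le_eqVlt; apply/orP; left; apply/eqP; field.
by rewrite gt_eqF.
Qed.
End Sample.
(** Chebyshev's inequality for the number of points followed by a gap longer
    than a, for any notion of gap between the two above; only a lower bound for
    the first moment and an upper bound for the second are needed. *)
Lemma chebyshev_gaps {R : realType} {d : measure_display} {T : measurableType d}
    {P : probability T R} {m : nat} (U : 'I_m -> {RV P >-> R})
    (hU : uniform01_sample U) (M : nat) (a q dl : R) (E : 'I_m -> T -> bool) :
  (0 < m)%N -> (0 < M)%N -> M%:R^-1 <= a -> a <= 2^-1 -> 0 <= q -> 0 <= dl ->
  (forall i, measurable_fun [set: T] (E i)) ->
  (forall i t, closed_gap_event U a i t -> E i t) ->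
  (forall i t, E i t -> open_gap_event U a i t) ->
  dl ^+ 2 *
    event_prob P (fun t => dl * m%:R <= `|\sum_i (E i t)%:R - q * m%:R|) <=
  m%:R^-1 + (M%:R^-1 + (1 - 2 * a + 2 / M%:R) ^+ m.-2)
    - 2 * q * (1 - a - M%:R^-1) ^+ m + q ^+ 2.
Proof.
move=> m0 M0 Ma a2 q0 dl0 mE cE oE.
have m0' : 0 < m%:R :> R by rewrite ltr0n.
set p2 := M%:R^-1 + _; set p1 := (1 - a - M%:R^-1) ^+ m.
set bad := fun t => _.
have mN : measurable_fun [set: T] (fun t => \sum_i (E i t)%:R : R).
  by apply: measurable_sum => i; exact: measurable_natb.
have mbad : measurable_fun [set: T] bad.
  apply: measurable_fun_ler => //; apply: measurableT_comp => //.
  exact: measurable_funB.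
have a0 : 0 <= a by apply: le_trans Ma; rewrite invr_ge0.
have E1 i : p1 <= event_prob P (E i).
  apply: le_trans (prob_closed_gap_ge hU i M0 a0 _) _; first by lra.
  apply: (le_prob (measurable_in_unit_interval U) (prob_in_unit_interval hU)) => //.
    exact: measurable_closed_gap_event.
  by move=> t _; exact: cE.
have Q0 : 0 <= (1 - 2 * a + 2 / M%:R) ^+ m.-2.
  by apply: exprn_ge0; rewrite addr_ge0 ?divr_ge0//; lra.
have Mi : 0 <= M%:R^-1 :> R by rewrite invr_ge0.
have E2 i j : event_prob P (fun t => E i t && E j t) <= (i == j)%:R + p2.
  have mEE : measurable_fun [set: T] (fun t => E i t && E j t) by exact: measurable_and.
  have [->|ij] := eqVneq i j.
    apply: (@le_trans _ _ 1); last by rewrite /p2 lerDl addr_ge0.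
    by apply: prob_le1; exact: measurable_and.
  rewrite add0r; apply: le_trans (prob_open_gap_pair hU ij M0 Ma a2).
  apply: (le_prob (measurable_in_unit_interval U) (prob_in_unit_interval hU)) => //.
    by apply: measurable_and; exact: measurable_open_gap_event.
  by move=> t _ /andP[/oE -> /oE ->].
pose c (k : ('I_m * 'I_m) + ('I_m + unit)) : R :=
  match k with inl _ => 1 | inr (inl _) => - (2 * q * m%:R)
             | inr (inr _) => (q * m%:R) ^+ 2 end.
pose b (k : ('I_m * 'I_m) + ('I_m + unit)) t :=
  match k with inl p => E p.1 t && E p.2 t | inr (inl i) => E i t
             | inr (inr _) => true end.
have mb k : measurable_fun [set: T] (b k).
  by case: k => [p|[i|[]]] /=; [exact: measurable_and|exact: mE|exact: measurable_cst].
have := @le_comb_prob _ _ _ P _ (measurable_in_unit_interval U) (prob_in_unit_interval hU)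
  unit _ (fun=> (dl * m%:R) ^+ 2) (fun=> bad) c b (fun=> mbad) mb.
have big_unit (f : unit -> R) : \sum_i f i = f tt.
  by rewrite (bigD1 tt)//= big1 ?addr0//; case.
rewrite big_unit !big_sumType/= big_unit.
rewrite event_probT.
move=> h.
have {}h : (dl * m%:R) ^+ 2 * event_prob P bad <=
    \sum_(p : 'I_m * 'I_m) 1 * event_prob P (fun t => E p.1 t && E p.2 t) +
    (\sum_(i < m) - (2 * q * m%:R) * event_prob P (E i) + (q * m%:R) ^+ 2 * 1).
  apply: h => t _; rewrite big_unit !big_sumType/= big_unit /b/= mulr1.
  have -> : \sum_(p : 'I_m * 'I_m) 1 * (E p.1 t && E p.2 t)%:R =
      (\sum_i (E i t)%:R) ^+ 2 :> R.
    rewrite expr2 big_distrlr/= pair_bigA/=; apply: eq_bigr => p _.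
    by rewrite mul1r -natrM mulnb.
  rewrite -mulr_sumr; set N := \sum_i (E i t)%:R.
  rewrite (_ : _ + _ = (N - q * m%:R) ^+ 2); last by ring.
  rewrite /bad -/N; case: (boolP (_ <= `|_|)) => [h|_]; last by rewrite mulr0 sqr_ge0.
  by rewrite mulr1 -[leRHS]real_normK ?num_real// lerXn2r// nnegrE mulr_ge0.
have s1 : \sum_(p : 'I_m * 'I_m) 1 * event_prob P (fun t => E p.1 t && E p.2 t) <=
    m%:R + m%:R ^+ 2 * p2.
  apply: (@le_trans _ _ (\sum_(p : 'I_m * 'I_m) ((p.1 == p.2)%:R + p2))).
    by apply: ler_sum => p _; rewrite mul1r.
  rewrite big_split/= sumr_const card_prod card_ord -[p2 *+ _]mulr_natl natrM -expr2.
  rewrite lerD2r -(pair_bigA _ (fun i j : 'I_m => (i == j)%:R : R))/=.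
  rewrite (eq_bigr (fun=> 1)) => [|i _]; first by rewrite sumr_const card_ord.
  by rewrite (bigD1 i)//= eqxx big1 ?addr0// => j; rewrite eq_sym => /negbTE ->.
have s2 : \sum_(i < m) - (2 * q * m%:R) * event_prob P (E i) <=
    - (2 * q * m%:R) * (m%:R * p1).
  rewrite -mulr_sumr !mulNr lerN2 ler_wpM2l ?mulr_ge0//.
  apply: (@le_trans _ _ (\sum_(i < m) p1)); last exact: ler_sum.
  by rewrite sumr_const card_ord mulr_natl.
rewrite -(ler_pM2l (exprn_gt0 2 m0')).
rewrite (_ : _ * (dl ^+ 2 * _) = (dl * m%:R) ^+ 2 * event_prob P bad); last by ring.
apply: (le_trans h); apply: (le_trans (lerD s1 (lerD s2 (lexx _)))).
rewrite le_eqVlt; apply/orP; left; apply/eqP; field.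
by rewrite gt_eqF.
Qed.
(** * Asymptotics of the gap probabilities *)

Section Limits.
Context {R : realType}.

Lemma cvg_invn : (fun n : nat => n%:R^-1 : R) @ \oo --> (0 : R).
Proof.
rewrite -(cvg_shiftS (fun n : nat => n%:R^-1 : R)); exact: cvg_harmonic.
Qed.

(** The right-hand side of Chebyshev's inequality for a = s / m, q = exp (- s)
    and M = m ^ 2 is at most this function at h = 1 / m. *)
Definition variance_bound (s h : R) : R :=
  h + (h ^+ 2 + expR ((2 * h - 2 * s) * (1 - 2 * h)))
  - 2 * expR (- s) * expR (- ((s + h) / (1 - s * h - h * h))) + expR (- s) ^+ 2.

Lemma cvg_variance_bound s :
  (fun n : nat => variance_bound s n%:R^-1) @ \oo --> (0 : R).
Proof.
have h0 := cvg_invn.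
have -> : 0 = 0 + (0 ^+ 2 + expR ((2 * 0 - 2 * s) * (1 - 2 * 0)))
  - 2 * expR (- s) * expR (- ((s + 0) / (1 - s * 0 - 0 * 0))) + expR (- s) ^+ 2 :> R.
  rewrite !mulr0 !subr0 addr0 divr1 mulr1 sub0r expr0n/= !add0r.
  rewrite -mulrA -expr2 (_ : - (2 * s) = - s + - s); last by ring.
  by rewrite expRD -expr2; ring.
have cE (f : nat -> R) (l : R) : f @ \oo --> l ->
    (fun n => expR (f n)) @ \oo --> expR l.
  by move=> fl; apply: continuous_cvg => //; exact: continuous_expR.
have c2h : (fun n : nat => 2 * n%:R^-1 : R) @ \oo --> (2 * 0 : R).
  by apply: cvgM => //; exact: cvg_cst.
apply: cvgD; last exact: cvg_cst.
apply: cvgB.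
  apply: cvgD => //; apply: cvgD.
    by rewrite expr2; under eq_fun do rewrite expr2; exact: cvgM.
  apply: cE.
  by apply: cvgM; apply: cvgB => //; exact: cvg_cst.
apply: cvgM; first exact: cvg_cst.
apply: cE.
apply: cvgN; apply: cvgM; first by apply: cvgD => //; exact: cvg_cst.
apply: cvgV; first by rewrite !mulr0 !subr0 oner_eq0.
apply: cvgB; last exact: cvgM.
by apply: cvgB; [exact: cvg_cst|apply: cvgM => //; exact: cvg_cst].
Qed.

(** From 1 + y <= exp y, and from 1 + z / (1 - z) <= exp (z / (1 - z)). *)
Lemma le_variance_bound (s : R) (m : nat) : (1 < m)%N -> 0 < s ->
  s * m%:R^-1 + m%:R^-1 * m%:R^-1 < 1 -> s / m%:R <= 2^-1 ->
  m%:R^-1 + ((m ^ 2)%:R^-1 + (1 - 2 * (s / m%:R) + 2 / (m ^ 2)%:R) ^+ m.-2)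
    - 2 * expR (- s) * (1 - s / m%:R - (m ^ 2)%:R^-1) ^+ m + expR (- s) ^+ 2
  <= variance_bound s m%:R^-1.
Proof.
move=> m1 s0 z1 a2; have m0 : 0 < m%:R :> R by rewrite ltr0n ltnW.
have mE : m%:R != 0 :> R by rewrite gt_eqF.
rewrite /variance_bound natrX -exprVn; set h := m%:R^-1 in z1 a2 *.
have h0 : 0 < h by rewrite invr_gt0.
rewrite lerD2r lerB//.
  rewrite !lerD2l.
  have -> : (2 * h - 2 * s) * (1 - 2 * h) = (2 * h ^+ 2 - 2 * (s * h)) * m.-2%:R.
    by rewrite -subn2 natrB// /h; field.
  rewrite expRM_natr lerXn2r ?nnegrE ?expR_ge0//.
    by rewrite addr_ge0 ?mulr_ge0 ?exprn_ge0// ?(ltW h0)//; lra.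
  by apply: le_trans (expR_ge1Dx _); rewrite addrA addrAC; lra.
rewrite ler_wpM2l ?mulr_ge0 ?expR_ge0//.
set z := s * h + h * h.
have z1' : 0 < 1 - z by rewrite /z; lra.
have -> : - ((s + h) / (1 - s * h - h * h)) = - (z / (1 - z)) * m%:R.
  rewrite /z opprD addrA (_ : s + h = (s * h + h * h) * m%:R); last first.
    by rewrite /h; field.
  by rewrite mulNr; congr (- _); rewrite -!mulrA; congr (_ * _); exact: mulrC.
rewrite expRM_natr (_ : 1 - _ - _ = 1 - z); last by rewrite /z expr2; ring.
rewrite lerXn2r ?nnegrE ?expR_ge0 ?(ltW z1')//.
rewrite expRN -[leRHS]invrK lef_pV2 ?posrE ?expR_gt0 ?invr_gt0//.
apply: le_trans (expR_ge1Dx _); rewrite le_eqVlt; apply/orP; left; apply/eqP.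
by field; rewrite gt_eqF.
Qed.

(** The proportion of points followed by a gap longer than s / m tends to
    exp (- s) in probability. *)
Lemma gaps_concentrate (s dl e : R) : 0 < s -> 0 < dl -> 0 < e ->
  exists N : nat, forall m : nat, (N <= m)%N ->
  forall (d : measure_display) (T : measurableType d) (P : probability T R)
    (U : 'I_m -> {RV P >-> R}), uniform01_sample U ->
  forall (E : 'I_m -> T -> bool),
  (forall i, measurable_fun [set: T] (E i)) ->
  (forall i t, closed_gap_event U (s / m%:R) i t -> E i t) ->
  (forall i t, E i t -> open_gap_event U (s / m%:R) i t) ->
  event_prob P
    (fun t => dl * m%:R <= `|\sum_i (E i t)%:R - expR (- s) * m%:R|) <= e.
Proof.
move=> s0 dl0 e0.
have c1 : \forall n \near \oo, variance_bound s n%:R^-1 < e * dl ^+ 2.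
  by apply: (cvgr_lt 0 (@cvg_variance_bound s)); rewrite mulr_gt0 ?exprn_gt0.
have c2 : \forall n \near \oo, n%:R^-1 < s :> R by exact: (cvgr_lt 0 cvg_invn).
have c3 : \forall n \near \oo, s * n%:R^-1 + n%:R^-1 * n%:R^-1 < 1 :> R.
  apply: (@cvgr_lt _ _ _ _ _ (s * 0 + 0 * 0)); last by rewrite !mulr0 addr0.
  by apply: cvgD; apply: cvgM => //; first [exact: cvg_cst|exact: cvg_invn].
have c4 : \forall n \near \oo, s * n%:R^-1 < 2^-1 :> R.
  apply: (@cvgr_lt _ _ _ _ _ (s * 0)); last by rewrite mulr0.
  by apply: cvgM => //; first [exact: cvg_cst|exact: cvg_invn].
have : \forall n \near \oo, [/\ variance_bound s n%:R^-1 < e * dl ^+ 2,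
   n%:R^-1 < s, s * n%:R^-1 + n%:R^-1 * n%:R^-1 < 1 & s * n%:R^-1 < 2^-1] /\ (1 < n)%N.
  near=> n; split; last by near: n; exact: nbhs_infty_gt.
  by split; near: n.
case=> N _ HN; exists N => m Nm d T P U hU E mE cE oE.
have [[h1 h2 h3 h4] m1] := HN m Nm.
have m0 : 0 < m%:R :> R by rewrite ltr0n ltnW.
have M0 : (0 < m ^ 2)%N by rewrite expn_gt0 ltnW.
rewrite -(ler_pM2l (exprn_gt0 2 dl0)).
have Ma : (m ^ 2)%:R^-1 <= s / m%:R.
  by rewrite natrX -exprVn expr2 ler_wpM2r ?invr_ge0// ltW.
apply: le_trans (chebyshev_gaps hU _ M0 Ma (ltW h4) (expR_ge0 _) (ltW dl0) mE cE oE) _.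
  exact: ltnW.
apply: le_trans (le_variance_bound m1 s0 h3 (ltW h4)) _.
by rewrite mulrC ltW.
Unshelve. all: by end_near.
Qed.

End Limits.
(** * Ordered spacings of a uniform sample *)

Lemma count_map_enum {R : realType} (N : nat) (y : 'I_N -> R) (p : pred R) :
  (count p [seq y i | i <- enum 'I_N])%:R = \sum_i (p (y i))%:R :> R.
Proof.
rewrite -sum1_count big_map big_enum_cond/= natr_sum big_mkcond /=.
by apply: eq_bigr => i _; case: (p _).
Qed.

Lemma measurable_order_statistic {R : realType} {d : measure_display}
    {T : measurableType d} (N : nat) (Y : 'I_N -> T -> R) (k : nat) :
  (forall i, measurable_fun [set: T] (Y i)) -> (0 < k <= N)%N ->
  measurable_fun [set: T]
    (fun t => order_statistic [seq Y i t | i <- enum 'I_N] k).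
Proof.
move=> mY kN.
apply: (measurability _ (RGenOInfty.measurableE R)) => //.
move=> /= _ [_ [a ->] <-]; rewrite setTI preimage_itvoy.
pose f t : R := k%:R + \sum_i (a < Y i t)%R%:R.
rewrite (_ : [set t | _] = [set t | (N%:R < f t :> R)]).
  apply: measurable_event; apply: measurable_fun_ltr => //.
  apply: measurable_funD => //; apply: measurable_sum => i.
  by apply: measurable_natb; exact: measurable_fun_ltr.
apply/funext => t; rewrite /mkset; congr is_true.
have sN : size [seq Y i t | i <- enum 'I_N] = N by rewrite size_map size_enum_ord.
rewrite order_statistic_gt sN//.
by rewrite /f -(count_map_enum (Y^~ t) (> a)) -natrD ltr_nat.
Qed.

Section OrderedSpacings.
Context {R : realType} {d : measure_display} {T : measurableType d}.
Context {P : probability T R} {m : nat}.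
Variable U : 'I_m -> {RV P >-> R}.
Local Notation mf := (measurable_fun [set: T]).
Local Notation sample t := [seq U i t | i <- enum 'I_m].
Local Notation spacing k := (ordered_spacing (n := m.+1) U k).

Lemma size_sample t : size (sample t) = m.
Proof. by rewrite size_map size_enum_ord. Qed.

Lemma measurable_endpoint k : (k <= m.+1)%N -> mf (fun t => nth 0 (endpoints (sample t)) k).
Proof.
case: k => [_|k]; first exact: measurable_cst.
rewrite ltnS leq_eqVlt => /orP[/eqP ->|km].
  rewrite (_ : (fun t => _) = cst 1); first exact: measurable_cst.
  by apply/funext => t; rewrite -[RHS](nth_endpoints_last (sample t)) size_sample.
rewrite (_ : (fun t => _) = fun t => order_statistic (sample t) k.+1).
  exact: (@measurable_order_statistic _ _ _ m (fun i t => U i t) k.+1).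
by apply/funext => t; rewrite nth_endpoints_sort ?size_sample.
Qed.

Lemma measurable_ordered_spacing k : (0 < k <= m.+1)%N -> mf (spacing k).
Proof.
move=> km; pose Y (i : 'I_m.+1) t :=
  nth 0 (endpoints (sample t)) i.+1 - nth 0 (endpoints (sample t)) i.
rewrite (_ : spacing k = fun t => order_statistic [seq Y i t | i <- enum 'I_m.+1] k).
  apply: measurable_order_statistic => // i; apply: measurable_funB.
    by apply: measurable_endpoint.
  by apply: measurable_endpoint; exact: ltnW.
apply/funext => t; rewrite -[LHS]/(order_statistic (spacings (sample t)) k).
congr order_statistic; apply: (@eq_from_nth _ 0).
  by rewrite size_spacings size_sample size_map size_enum_ord.
move=> i; rewrite size_spacings size_sample => im.
rewrite nth_spacings ?size_sample//.
by rewrite (nth_map ord0) ?size_enum_ord// /Y nth_enum_ord.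
Qed.

Section Pointwise.
Variable t : T.
Hypothesis Dt : in_unit_interval U t.

Lemma sample01 : all (fun v : R => 0 <= v <= 1) (sample t).
Proof.
apply/allP => v /mapP[i _ ->]; have /forallP/(_ i)/andP[-> v1] := Dt.
exact: ltW.
Qed.

Lemma ordered_spacing_ge0 k : (0 < k <= m.+1)%N -> 0 <= spacing k t.
Proof.
move=> km; apply: (allP (spacings_ge0 sample01)); apply: order_statistic_mem.
by rewrite size_spacings size_sample.
Qed.

Lemma ordered_spacing_le k : (0 < k <= m.+1)%N ->
  spacing k t * (m.+1 - k).+1%:R <= 1.
Proof.
move=> km; rewrite -[leRHS](sum_spacings (sample t)).
have := @order_statistic_le_sum _ (spacings (sample t)) k.
by rewrite size_spacings size_sample; apply => //; exact: spacings_ge0 sample01.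
Qed.

(** A long k-th ordered spacing forces many gaps. *)
Lemma ordered_spacing_gt a k : (0 < k <= m.+1)%N -> a < spacing k t ->
  (m.+1 - k)%:R <= \sum_i (open_gap_event U a i t)%:R :> R.
Proof.
move=> km; rewrite order_statistic_gt ?size_spacings ?size_sample// => h.
apply: (@le_trans _ _ (count (open_gap (sample t) a) (sample t))%:R).
  rewrite ler_nat leq_subLR.
  have := count_spacings_le sample01 a; rewrite -(leq_add2l k) => h'.
  have := leq_trans h h'; rewrite addnS; exact.
rewrite (count_map_enum (fun i => U i t)); apply: ler_sum => i _; rewrite ler_nat.
case: (boolP (open_gap _ _ _)) => // /andP[Ui /allP gi].
suff -> : open_gap_event U a i t by [].
rewrite /open_gap_event Ui; apply/forallP => j.
by apply: gi; apply: map_f; rewrite mem_enum.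
Qed.

(** A short k-th ordered spacing leaves few gaps. *)
Lemma ordered_spacing_le_gaps a k : (0 < k <= m.+1)%N -> spacing k t <= a ->
  \sum_i (closed_gap_event U a i t)%:R <= (m.+1 - k)%:R :> R.
Proof.
move=> km; rewrite leNgt order_statistic_gt ?size_spacings ?size_sample//.
rewrite -leqNgt => h.
apply: (@le_trans _ _ (count (closed_gap (sample t) a) (sample t))%:R); last first.
  rewrite ler_nat leq_subRL; last by case/andP: km.
  by apply: leq_trans h; rewrite leq_add2l; exact: le_count_spacings (sample t) a.
rewrite (count_map_enum (fun i => U i t)); apply: ler_sum => i _; rewrite ler_nat.
case: (boolP (closed_gap_event _ _ _ _)) => // /andP[Ui /forallP gi].
suff -> : closed_gap (sample t) a (U i t) by [].
rewrite /closed_gap Ui/= count_map.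
have := count_uniq_mem i (enum_uniq 'I_m); rewrite mem_enum /= => <-.
apply: sub_in_count => j _ /=; apply: contraTT => ji.
by have := gi j; rewrite ji.
Qed.

(** A long spacing forces an empty cell. *)
Lemma ordered_spacing_empty_cell M k : (0 < M)%N -> (0 < k <= m.+1)%N ->
  2 / M%:R < spacing k t ->
  exists c : 'I_M, [forall i, ~~ in_cell M c (U i t)].
Proof.
move=> M0 km h.
have ks : (0 < k <= (size (sample t)).+1)%N by rewrite size_sample.
have [c /allP hc] := empty_cell sample01 M0 ks h.
by exists c; apply/forallP => i; apply: hc; apply: map_f; rewrite mem_enum.
Qed.

End Pointwise.
End OrderedSpacings.
(** * Mean ordered spacings and their limit *)

Section AffineBounds.
Context {R : realType} {d : measure_display} {T : measurableType d}.
Variables (P : probability T R) (D : T -> bool).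
Local Notation mf := (measurable_fun [set: T]).
Hypotheses (mD : mf D) (D1 : event_prob P D = 1).

Lemma mean_affine (c c' : R) (b : T -> bool) : mf b ->
  mean P (fun t => c + c' * (b t)%:R) = c + c' * event_prob P b.
Proof.
move=> mb; pose f (k : bool) : R := if k then c else c'.
pose g (k : bool) t := if k then true else b t.
have mg k : mf (g k) by case: k => //=; exact: measurable_cst.
have := mean_sum P f mg; rewrite big_bool/= event_probT mulr1 => <-.
by congr (mean _ _); apply/funext => t; rewrite big_bool/= mulr1.
Qed.

Lemma measurable_affine (c c' : R) (b : T -> bool) : mf b ->
  mf (fun t => c + c' * (b t)%:R).
Proof.
move=> mb; apply: measurable_funD => //; apply: measurable_funM => //.
exact: measurable_natb.
Qed.

Lemma affine_bounded (c c' : R) (b : T -> bool) t :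
  `|c + c' * (b t)%:R| <= `|c| + `|c'|.
Proof.
apply: le_trans (ler_normD _ _) _; rewrite lerD2l normrM ler_piMr//.
by rewrite ger0_norm// lern1 leq_b1.
Qed.

Variables (X : T -> R) (c c' : R) (b : T -> bool).
Hypotheses (mX : mf X) (mb : mf b) (X01 : forall t, D t -> 0 <= X t <= 1).

Let X_bounded t : D t -> `|X t| <= Num.max 1 (`|c| + `|c'|).
Proof. by move=> /X01/andP[X0 X1]; rewrite le_max ger0_norm// X1. Qed.

Let affine_max t : `|c + c' * (b t)%:R| <= Num.max 1 (`|c| + `|c'|).
Proof. by rewrite le_max affine_bounded orbT. Qed.

Lemma mean_le_affine : (forall t, D t -> X t <= c + c' * (b t)%:R) ->
  mean P X <= c + c' * event_prob P b.
Proof.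
move=> h; rewrite -mean_affine//; apply: (le_mean mD D1 _ _ X_bounded) => //.
exact: measurable_affine.
Qed.

Lemma mean_ge_affine : (forall t, D t -> c + c' * (b t)%:R <= X t) ->
  c + c' * event_prob P b <= mean P X.
Proof.
move=> h; rewrite -mean_affine//.
apply: (le_mean mD D1 _ _ (fun t _ => affine_max t) X_bounded) => //.
exact: measurable_affine.
Qed.

End AffineBounds.

Section MeanSpacings.
Context {R : realType} {d : measure_display} {T : measurableType d}.
Context {P : probability T R} {m : nat}.
Variable U : 'I_m -> {RV P >-> R}.
Hypothesis hU : uniform01_sample U.
Local Notation mf := (measurable_fun [set: T]).
Local Notation spacing k := (ordered_spacing (n := m.+1) U k).
Local Notation D := (in_unit_interval U).
Local Notation mD := (measurable_in_unit_interval U).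
Local Notation D1 := (prob_in_unit_interval hU).

Lemma ordered_spacing01 k t : (0 < k <= m.+1)%N -> D t -> 0 <= spacing k t <= 1.
Proof.
move=> km Dt; rewrite ordered_spacing_ge0//=.
apply: le_trans (ordered_spacing_le Dt km).
by rewrite ler_peMr ?ordered_spacing_ge0// ler1n.
Qed.

Lemma mean_ordered_spacing_ge0 k : (0 < k <= m.+1)%N ->
  0 <= mean_ordered_spacing (n := m.+1) U k.
Proof.
move=> km; rewrite -[leRHS]/(mean P (spacing k)).
have := @mean_ge_affine _ _ _ P _ mD D1 (spacing k) 0 0 D (measurable_ordered_spacing U km) mD.
rewrite !mul0r addr0; apply=> t Dt; first exact: ordered_spacing01.
by rewrite mul0r addr0 ordered_spacing_ge0.
Qed.

(** A spacing longer than 2 / K forces one of the K cells to be empty. *)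
Lemma mean_largest_spacing_le K : (0 < K)%N ->
  mean_ordered_spacing (n := m.+1) U m.+1 <= 2 / K%:R + K%:R * (1 - K%:R^-1) ^+ m.
Proof.
move=> K0; rewrite -[leLHS]/(mean P (spacing m.+1)).
have km : (0 < m.+1 <= m.+1)%N by rewrite leqnn.
pose g (c : 'I_K) t := [forall i, ~~ in_cell K c (U i t)].
have mg c : mf (g c).
  apply: measurable_forall => i; apply: measurable_neg.
  exact: measurableT_comp (measurable_in_cell _ _) _.
pose b t := ~~ [forall c, ~~ g c t].
have mb : mf b.
  by apply: measurable_neg; apply: measurable_forall => c; exact: measurable_neg.
apply: (@le_trans _ _ (2 / K%:R + 1 * event_prob P b)).
  apply: (mean_le_affine mD D1) => // [|t Dt|t Dt].
  - exact: measurable_ordered_spacing.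
  - exact: ordered_spacing01.
  - rewrite mul1r; have [bt|nb] := boolP (b t).
      have /andP[_ /le_trans] := ordered_spacing01 km Dt; apply.
      by rewrite lerDr divr_ge0.
    rewrite addr0 leNgt; apply/negP => h.
    have [c gc] := ordered_spacing_empty_cell Dt K0 km h.
    by move: nb; rewrite negbK => /forallP/(_ c); rewrite /g gc.
rewrite lerD2l mul1r; apply: (@le_trans _ _ (\sum_c event_prob P (g c))).
  apply: (prob_le_sum mD D1) => // t _; rewrite /b negb_forall => /existsP[c].
  by rewrite negbK; exists c.
rewrite (eq_bigr (fun=> (1 - K%:R^-1) ^+ m)) => [|c _].
  by rewrite sumr_const card_ord mulr_natl.
exact: prob_empty_cell.
Qed.

End MeanSpacings.

(** The mean of the largest spacing tends to 0, uniformly over all samples. *)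
Lemma cvg_mean_largest_spacing {R : realType} (e : R) : 0 < e ->
  exists N : nat, forall m : nat, (N <= m)%N ->
  forall (d : measure_display) (T : measurableType d) (P : probability T R)
    (U : 'I_m -> {RV P >-> R}), uniform01_sample U ->
  mean_ordered_spacing (n := m.+1) U m.+1 <= e.
Proof.
move=> e0.
have [K _ hK] : \forall K \near \oo, K%:R^-1 < e / 4 :> R.
  by apply: (cvgr_lt 0 cvg_invn); rewrite divr_gt0.
have {}hK := hK K.+1 (leqnSn K).
have c1 : (fun m : nat => K.+1%:R * (1 - K.+1%:R^-1) ^+ m : R) @ \oo --> K.+1%:R * (0 : R).
  apply: cvgM; first exact: cvg_cst.
  apply: cvg_expr; rewrite ger0_norm; last by rewrite subr_ge0 invf_le1 ?ler1n// ltr0n.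
  by rewrite gtrBl invr_gt0 ltr0n.
have [N _ HN] : \forall m \near \oo, K.+1%:R * (1 - K.+1%:R^-1) ^+ m < e / 2 :> R.
  by apply: (cvgr_lt _ c1); rewrite mulr0 divr_gt0.
exists N => m /HN /= h d T P U hU.
apply: le_trans (mean_largest_spacing_le hU (ltn0Sn K)) _.
have hK2 : 2 / K.+1%:R <= e / 2 by move: hK => /=; move: (K.+1%:R^-1) => y hy; lra.
by rewrite [leRHS](splitr e) lerD// ltW.
Qed.

(** Here m + 1 - k is the number of spacings of rank larger than k among the
    m + 1 spacings; it is m (1 - x) up to a unit. *)
Lemma rank_bounds {R : realType} (m : nat) (x : R) : (0 < m)%N -> 0 < x -> x < 1 ->
  let k := absz (Num.ceil (m%:R * x)) in
  [/\ (0 < k <= m.+1)%N, m%:R * (1 - x) <= (m.+1 - k)%:R &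
      (m.+1 - k)%:R <= m%:R * (1 - x) + 1].
Proof.
move=> m0 x0 x1 k; have m0' : 0 < m%:R :> R by rewrite ltr0n.
have c0 : 0 < Num.ceil (m%:R * x) by rewrite ceil_gt0 mulr_gt0.
have kE : k%:R = (Num.ceil (m%:R * x))%:~R :> R by rewrite /k natr_absz gtr0_norm.
have k1 : k%:R < m%:R * x + 1.
  by rewrite kE -ltrBlDr; have := ceilB1_lt (m%:R * x); rewrite intrB.
have k2 : m%:R * x <= k%:R by rewrite kE; exact: ceil_ge.
have k0 : (0 < k)%N by rewrite absz_gt0 gt_eqF.
have km : (k <= m.+1)%N.
  rewrite -(@ler_nat R) -natr1; apply: (le_trans (ltW k1)); rewrite lerD2r.
  by rewrite ger_pMr// ltW.
by split; rewrite ?k0// natrB// -natr1; lra.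
Qed.

Section Rescaled.
Context {R : realType} (x : R).
Hypotheses (x0 : 0 < x) (x1 : x < 1).
Local Notation k m := (absz (Num.ceil (m%:R * x))).

(** If m S_k > s := - ln (1 - x) + e / 2, then at least a proportion 1 - x of the
    points are followed by a gap longer than s / m, whereas the expected
    proportion is about exp (- s) < 1 - x. On this unlikely event S_k is at most
    1 / (m (1 - x)). *)
Lemma mean_spacing_upper (e : R) : 0 < e ->
  exists N : nat, forall m : nat, (N <= m)%N ->
  forall (d : measure_display) (T : measurableType d) (P : probability T R)
    (U : 'I_m -> {RV P >-> R}), uniform01_sample U ->
  m%:R * mean_ordered_spacing (n := m.+1) U (k m) <= - ln (1 - x) + e.
Proof.
move=> e0; have y0 : 0 < 1 - x by rewrite subr_gt0.
have l0 : 0 < - ln (1 - x) by rewrite oppr_gt0 ln_lt0// y0/= gtrBl.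
pose s := - ln (1 - x) + e / 2; have s0 : 0 < s by rewrite addr_gt0 ?divr_gt0.
pose dl := (1 - x) - expR (- s).
have dl0 : 0 < dl.
  rewrite subr_gt0 -[ltRHS]lnK ?posrE// ltr_expR /s; lra.
have e'0 : 0 < (1 - x) * (e / 2) by rewrite mulr_gt0 ?divr_gt0.
have [N HN] := gaps_concentrate s0 dl0 e'0.
exists (maxn N 1) => m; rewrite geq_max => /andP[Nm m1] d T P U hU.
have m0 : 0 < m%:R :> R by rewrite ltr0n.
have [km kl ku] := rank_bounds m1 x0 x1.
have := HN m Nm d T P U hU _ (measurable_open_gap_event U (s / m%:R)).
set bad := fun t => _; move=> /(_ _ (fun _ _ => id)) h.
have {}h : event_prob P bad <= (1 - x) * (e / 2).
  by apply: h => i t; exact: closed_gap_open.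
have mbad : measurable_fun [set: T] bad.
  apply: measurable_fun_ler => //; apply: measurableT_comp => //.
  apply: measurable_funB => //; apply: measurable_sum => i.
  by apply: measurable_natb; exact: measurable_open_gap_event.
have : mean_ordered_spacing (n := m.+1) U (k m) <=
    s / m%:R + (m%:R * (1 - x))^-1 * event_prob P bad.
  apply: (mean_le_affine (measurable_in_unit_interval U) (prob_in_unit_interval hU)) => //.
  - exact: measurable_ordered_spacing.
  - by move=> t; exact: ordered_spacing01.
  - move=> t Dt; have [bt|nb] := boolP (bad t).
      (* The m + 2 - k spacings of rank at least k sum up to at most 1. *)
      apply: (@le_trans _ _ ((m%:R * (1 - x))^-1)); last first.
        by rewrite mulr1 lerDr divr_ge0// ltW.
      rewrite -[leRHS]mul1r ler_pdivlMr ?mulr_gt0//.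
      apply: le_trans (ordered_spacing_le Dt km).
      rewrite ler_wpM2l ?ordered_spacing_ge0//; apply: (le_trans kl).
      by rewrite ler_nat.
    rewrite mulr0 addr0 leNgt; apply: contra nb => /(ordered_spacing_gt Dt km) h'.
    rewrite /bad; apply: le_trans (ler_norm _); rewrite /dl.
    by have := le_trans kl h'; lra.
move=> /(ler_wpM2l (ltW m0)) /le_trans; apply.
have -> (a p : R) : m%:R * (a / m%:R + (m%:R * (1 - x))^-1 * p) = a + p / (1 - x).
  by field; rewrite !gt_eqF.
have : event_prob P bad / (1 - x) <= e / 2 by rewrite ler_pdivrMr// mulrC.
rewrite /s; lra.
Qed.

(** If m S_k <= s := - ln (1 - x) - e / 2, then at most a proportion 1 - x, up to
    1 / m, of the points are followed by a gap longer than s / m, whereas the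
    expected proportion is about exp (- s) > 1 - x. *)
Lemma mean_spacing_lower (e : R) : 0 < e ->
  exists N : nat, forall m : nat, (N <= m)%N ->
  forall (d : measure_display) (T : measurableType d) (P : probability T R)
    (U : 'I_m -> {RV P >-> R}), uniform01_sample U ->
  - ln (1 - x) - e <= m%:R * mean_ordered_spacing (n := m.+1) U (k m).
Proof.
move=> e0; have y0 : 0 < 1 - x by rewrite subr_gt0.
have l0 : 0 < - ln (1 - x) by rewrite oppr_gt0 ln_lt0// y0/= gtrBl.
(* For larger e the bound is negative; otherwise s below is positive. *)
have [el|le] := ltP (- ln (1 - x)) e.
  exists 1%N => m m1 d T P U hU; apply: (@le_trans _ _ 0); first by lra.
  have [km _ _] := rank_bounds m1 x0 x1.
  by rewrite mulr_ge0// mean_ordered_spacing_ge0.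
pose s := - ln (1 - x) - e / 2; have s0 : 0 < s by rewrite /s; lra.
pose dl := (expR (- s) - (1 - x)) / 2.
have dl0 : 0 < dl.
  by rewrite divr_gt0// subr_gt0 -[ltLHS]lnK ?posrE// ltr_expR /s; lra.
have e'0 : 0 < e / 2 / s by rewrite !divr_gt0.
have [N HN] := gaps_concentrate s0 dl0 e'0.
have [N' _ HN'] : \forall m \near \oo, m%:R^-1 < dl by exact: (cvgr_lt 0 cvg_invn).
exists (maxn N (maxn N' 1)) => m; rewrite !geq_max => /and3P[Nm N'm m1] d T P U hU.
have m0 : 0 < m%:R :> R by rewrite ltr0n.
have dlm : 1 < dl * m%:R by rewrite -ltr_pdivrMr// mul1r; exact: HN'.
have [km kl ku] := rank_bounds m1 x0 x1.
have := HN m Nm d T P U hU _ (measurable_closed_gap_event U (s / m%:R)).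
set bad := fun t => _; move=> /(_ (fun _ _ => id)) h.
have {}h : event_prob P bad <= e / 2 / s.
  by apply: h => i t; exact: closed_gap_open.
have mbad : measurable_fun [set: T] bad.
  apply: measurable_fun_ler => //; apply: measurableT_comp => //.
  apply: measurable_funB => //; apply: measurable_sum => i.
  by apply: measurable_natb; exact: measurable_closed_gap_event.
have : s / m%:R + - (s / m%:R) * event_prob P bad <=
    mean_ordered_spacing (n := m.+1) U (k m).
  apply: (mean_ge_affine (measurable_in_unit_interval U) (prob_in_unit_interval hU)) => //.
  - exact: measurable_ordered_spacing.
  - by move=> t; exact: ordered_spacing01.
  - move=> t Dt; have [bt|nb] := boolP (bad t).
      by rewrite mulr1 subrr ordered_spacing_ge0.
    rewrite mulr0 addr0 leNgt; apply: contra nb => /ltW.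
    move=> /(ordered_spacing_le_gaps km) h'.
    rewrite /bad -normrN; apply: le_trans (ler_norm _).
    by have := le_trans h' ku; move: dlm; rewrite /dl; lra.
move=> /(ler_wpM2l (ltW m0)); apply: le_trans.
have -> (a p : R) : m%:R * (a / m%:R + - (a / m%:R) * p) = a - p * a.
  by field; rewrite gt_eqF.
have : event_prob P bad * s <= e / 2 by rewrite -ler_pdivlMr.
rewrite /s; lra.
Qed.

End Rescaled.

Theorem proposition4p6 (R : realType)
    (d : nat -> measure_display) (T : forall n : nat, measurableType (d n))
    (P : forall n : nat, probability (T n) R)
    (U : forall n : nat, 'I_n.-1 -> {RV (P n) >-> R})
    (hU : forall n : nat, (2 <= n)%N -> uniform01_sample (U n))
    (x : R) (hx0 : 0 < x) (hx1 : x < 1) :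
  (fun n : nat => expected_betti0 (U n) x) @ \oo --> - ln (1 - x).
Proof.
(* The value of the function is A n / (1 - B n). *)
pose A n := n.-1%:R *
  mean_ordered_spacing (U n) (absz (Num.ceil (n.-1%:R * x))).
pose B n := mean_ordered_spacing (U n) n.
have cA : A @ \oo --> - ln (1 - x).
  apply/cvgrPdist_le => e e0.
  have [N1 H1] := mean_spacing_upper hx0 hx1 e0.
  have [N2 H2] := mean_spacing_lower hx0 hx1 e0.
  exists (maxn 2 (maxn N1.+1 N2.+1)) => // -[|n] /=; rewrite !geq_max // => /and3P[n2 n1' n2'].
  have h1 := H1 n n1' _ _ _ _ (hU n.+1 n2); have h2 := H2 n n2' _ _ _ _ (hU n.+1 n2).
  by rewrite ler_norml /A/=; apply/andP; split; lra.
have cB : B @ \oo --> (0 : R).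
  apply/cvgrPdist_le => e e0.
  have [N H] := cvg_mean_largest_spacing e0.
  exists (maxn 2 N.+1) => // -[|n] /=; rewrite !geq_max // => /andP[n2 n1].
  have h := H n n1 _ _ _ _ (hU n.+1 n2).
  by rewrite sub0r normrN ger0_norm// (mean_ordered_spacing_ge0 (hU n.+1 n2)) ?leqnn.
rewrite (_ : (fun n => _) = fun n => A n * (1 - B n)^-1); last first.
  by apply/funext => n; rewrite /expected_betti0 /betti0_const mulrAC.
rewrite -[- ln _]mulr1 -[X in _ * X]invr1 -[X in _ * X^-1]subr0.
apply: cvgM => //; apply: cvgV; first by rewrite subr0 oner_eq0.
by apply: cvgB => //; exact: cvg_cst.
Qed.
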